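(* Let $p$ be an odd prime, let $\lambda, x, y\in\mathbb{C}_p$ with $\lambda\neq 0$, let $w_1,w_2\in\mathbb{N}$ with $w_1\equiv 1 \pmod 2$ and $w_2\equiv 1\pmod 2$, let $n\ge 0$ be an integer and let $m\in\mathbb{N}$. Then $$\sum_{j=0}^{n}\binom{n}{j}w_{2}^{j}w_{1}^{n-j}\,\mathcal{E}_{n-j}^{(m)}\left(w_{2}x\,\Big|\,\frac{\lambda}{w_{1}}\right)\sum_{k=0}^{j}\tilde{S}_{k}\left(w_{1}-1\,\Big|\,\frac{\lambda}{w_{2}}\right)\binom{j}{k}\mathcal{E}_{j-k}^{(m-1)}\left(w_{1}y\,\Big|\,\frac{\lambda}{w_{2}}\right)$$ $$=\sum_{j=0}^{n}\binom{n}{j}w_{1}^{j}w_{2}^{n-j}\,\mathcal{E}_{n-j}^{(m)}\left(w_{1}x\,\Big|\,\frac{\lambda}{w_{2}}\right)\sum_{k=0}^{j}\tilde{S}_{k}\left(w_{2}-1\,\Big|\,\frac{\lambda}{w_{1}}\right)\binom{j}{k}\mathcal{E}_{j-k}^{(m-1)}\left(w_{2}y\,\Big|\,\frac{\lambda}{w_{1}}\right).$$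
   Context: $\mathbb{N}=\{1,2,3,\dots\}$, and $\mathbb{C}_p$ is the completion of the algebraic closure of the field $\mathbb{Q}_p$ of $p$-adic numbers. For $n\ge 0$ put $(x\mid\lambda)_n = x(x-\lambda)(x-2\lambda)\cdots(x-(n-1)\lambda)$, with $(x\mid\lambda)_0=1$. As a formal power series in $t$, $(1+\lambda t)^{x/\lambda}=\sum_{n\ge 0}(x\mid\lambda)_n\frac{t^n}{n!}$. For an integer $r\ge 0$, the higher-order degenerate Euler polynomials $\mathcal{E}_n^{(r)}(x\mid\lambda)$ are defined by $$\left(\frac{2}{(1+\lambda t)^{1/\lambda}+1}\right)^{r}(1+\lambda t)^{x/\lambda}=\sum_{n=0}^{\infty}\mathcal{E}_n^{(r)}(x\mid\lambda)\frac{t^n}{n!}$$ (for $r=0$ the first factor is $1$, so $\mathcal{E}_n^{(0)}(x\mid\lambda)=(x\mid\lambda)_n$). For integers $k,n\ge 0$, $\tilde{S}_k(n\mid\lambda)=\sum_{l=0}^{n}(-1)^l (l\mid\lambda)_k$. *)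

(* Defs.v *)
From HB Require Import structures.
From mathcomp Require Import all_boot all_order all_algebra.
From mathcomp Require Import reals.

Set Implicit Arguments.
Unset Strict Implicit.
Unset Printing Implicit Defensive.

Import Order.TTheory GRing.Theory Num.Theory.
Local Open Scope ring_scope.

(* The library's norms (normedZmodType) satisfy `|x *+ n| = `|x| *+ n and hence
   exclude p-adic ones; absolute values are therefore introduced here. *)
Record ultrametric_abs (R : realType) (K : fieldType) (v : K -> R) : Prop := {
  abs_ge0 : forall x, 0 <= v x;
  abs_eq0 : forall x, v x = 0 <-> x = 0;
  absM : forall x y, v (x * y) = v x * v y;
  absD : forall x y, v (x + y) <= Num.max (v x) (v y)
}.

Definition abs_cauchy (R : realType) (K : fieldType) (v : K -> R)
    (u : nat -> K) : Prop :=
  forall e : R, 0 < e -> exists N : nat, forall i j : nat,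
    (N <= i)%N -> (N <= j)%N -> v (u i - u j) < e.

Definition abs_converges (R : realType) (K : fieldType) (v : K -> R)
    (u : nat -> K) (l : K) : Prop :=
  forall e : R, 0 < e -> exists N : nat, forall i : nat,
    (N <= i)%N -> v (u i - l) < e.

(* (K, vK) is the completion of (F, vF) along the embedding i. *)
Record is_completion (R : realType) (F K : fieldType) (vF : F -> R)
    (vK : K -> R) (i : F -> K) : Prop := {
  completion_isometry : forall a, vK (i a) = vF a;
  completion_dense : forall (x : K) (e : R), 0 < e ->
    exists a : F, vK (x - i a) < e;
  completion_complete : forall u : nat -> K,
    abs_cauchy vK u -> exists l : K, abs_converges vK u l
}.

(* `|q|_p = p ^ (v_p(denominator) - v_p(numerator)), the exponent being an
   integer. *)
Definition padic_abs (R : realType) (p : nat) (q : rat) : R :=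
  if q == 0 then 0
  else (p%:R : R) ^
    ((logn p `|denq q|%N)%:Z - (logn p `|numq q|%N)%:Z).

(* A field C_p given together with the tower rat -> Q_p -> Qbar_p -> C_p that
   defines it, each stage being unique up to isometric isomorphism: Q_p is the
   completion of rat for the p-adic absolute value, Qbar_p is an algebraic
   closure of Q_p with the absolute value extending that of Q_p, and C_p is
   the completion of Qbar_p. *)
Record padicComplex (R : realType) (p : nat) := PadicComplex {
  Qp : fieldType;
  Qp_abs : Qp -> R;
  rat_Qp : {rmorphism rat -> Qp};
  Qp_absP : ultrametric_abs Qp_abs;
  Qp_completion : is_completion (padic_abs R p) Qp_abs rat_Qp;

  Qpbar : closedFieldType;
  Qpbar_abs : Qpbar -> R;
  Qp_Qpbar : {rmorphism Qp -> Qpbar};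
  Qpbar_algebraic : forall z : Qpbar, algebraicOver Qp_Qpbar z;
  Qpbar_absP : ultrametric_abs Qpbar_abs;
  Qpbar_abs_extends : forall a : Qp, Qpbar_abs (Qp_Qpbar a) = Qp_abs a;

  Cp :> fieldType;
  Cp_abs : Cp -> R;
  Qpbar_Cp : {rmorphism Qpbar -> Cp};
  Cp_absP : ultrametric_abs Cp_abs;
  Cp_completion : is_completion Qpbar_abs Cp_abs Qpbar_Cp
}.

(* A formal power series over K is its coefficient function nat -> K. *)

Definition fps_const (K : fieldType) (c : K) : nat -> K :=
  fun n => if n == 0%N then c else 0.

Definition fps_add (K : fieldType) (f g : nat -> K) : nat -> K :=
  fun n => f n + g n.

Definition fps_mul (K : fieldType) (f g : nat -> K) : nat -> K :=
  fun n => \sum_(i < n.+1) f i * g (n - i)%N.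

Definition fps_exp (K : fieldType) (f : nat -> K) (r : nat) : nat -> K :=
  iter r (fps_mul f) (fps_const 1).

(* First n coefficients of 1 / f, computed by solving (1 / f) * f = 1. *)
Fixpoint fps_inv_seq (K : fieldType) (f : nat -> K) (n : nat) : seq K :=
  if n is k.+1 then
    let s := fps_inv_seq f k in
    rcons s ((fps_const 1 k - \sum_(i < k) s`_i * f (k - i)%N) / f 0%N)
  else [::].

Definition fps_inv (K : fieldType) (f : nat -> K) : nat -> K :=
  fun n => (fps_inv_seq f n.+1)`_n.

Lemma size_fps_inv_seq (K : fieldType) (f : nat -> K) (n : nat) :
  size (fps_inv_seq f n) = n.
Proof. by elim: n => //= n IHn; rewrite size_rcons IHn. Qed.

Lemma nth_fps_inv_seq (K : fieldType) (f : nat -> K) (n i : nat) :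
  (i < n)%N -> (fps_inv_seq f n)`_i = fps_inv f i.
Proof.
elim: n => // n IHn; rewrite ltnS leq_eqVlt => /predU1P[-> //|lt_in].
by rewrite /= nth_rcons size_fps_inv_seq lt_in IHn.
Qed.

Lemma fps_mulVf (K : fieldType) (f : nat -> K) :
  f 0%N != 0 -> fps_mul (fps_inv f) f =1 fps_const 1.
Proof.
move=> f0 n; rewrite /fps_mul big_ord_recr /= subnn.
rewrite {2}/fps_inv /= nth_rcons size_fps_inv_seq ltnn eqxx divfK //.
rewrite addrC -addrA (eq_bigr (fun i : 'I_n => fps_inv f i * f (n - i)%N)).
  by rewrite addNr addr0.
by move=> i _; rewrite nth_fps_inv_seq.
Qed.

(* (x | lambda)_n *)
Definition dfact (K : fieldType) (x lambda : K) (n : nat) : K :=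
  \prod_(i < n) (x - i%:R * lambda).

(* (1 + lambda t)^(x / lambda); see dexp_binomial for the comparison with the
   binomial series. *)
Definition dexp (K : fieldType) (lambda x : K) : nat -> K :=
  fun n => dfact x lambda n / n`!%:R.

Lemma dexp_binomial (K : fieldType) (lambda x : K) (n : nat) :
  lambda != 0 ->
  dexp lambda x n =
    (\prod_(i < n) (x / lambda - i%:R)) / n`!%:R * lambda ^+ n.
Proof.
move=> l0; rewrite /dexp mulrAC; congr (_ / _).
rewrite -[X in lambda ^+ X]card_ord -prodr_const -big_split /=.
by apply: eq_bigr => i _; rewrite mulrBl divfK.
Qed.

(* (2 / ((1 + lambda t)^(1 / lambda) + 1))^r (1 + lambda t)^(x / lambda) *)
Definition deuler_gf (K : fieldType) (r : nat) (x lambda : K) : nat -> K :=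
  fps_mul
    (fps_exp
       (fps_mul (fps_const 2)
          (fps_inv (fps_add (dexp lambda 1) (fps_const 1)))) r)
    (dexp lambda x).

(* E_n^(r)(x | lambda), as the coefficient of t^n / n! *)
Definition deuler (K : fieldType) (r n : nat) (x lambda : K) : K :=
  n`!%:R * deuler_gf r x lambda n.

Definition dSsum (K : fieldType) (k n : nat) (lambda : K) : K :=
  \sum_(l < n.+1) (-1) ^+ l * dfact l%:R lambda k.

(* Main.v *)
Require Import Defs.
From HB Require Import structures.
From mathcomp Require Import all_boot all_order all_algebra.
From mathcomp Require Import boolp.
From mathcomp Require Import reals.
From mathcomp Require Import ring.

Import Order.TTheory GRing.Theory Num.Theory.
Local Open Scope ring_scope.

(* With e(z) = (1 + lambda t)^(z / lambda), after the substitutions t -> w1 t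
   and t -> w2 t in the two factors, the left-hand side is n! times the
   coefficient of t^n in
     (2 / (e(w1) + 1))^m e(w1 w2 x) * S * (2 / (e(w2) + 1))^(m-1) e(w1 w2 y)
   where S = sum_(l < w1) (-1)^l e(w2)^l.  Since w1 is odd, S is
   (e(w1 w2) + 1) / (e(w2) + 1), so the series is symmetric in w1 and w2. *)

(** A separate name lets series carry the Cauchy product rather than pointwise multiplication of
    functions. *)
Definition fps (K : fieldType) : Type := nat -> K.

Set Implicit Arguments.
Unset Strict Implicit.

(** * The commutative ring of formal power series *)

Section FpsRing.
Variable K : fieldType.

HB.instance Definition _ := gen_eqMixin (fps K).
HB.instance Definition _ := gen_choiceMixin (fps K).

Definition fps_opp (f : fps K) : fps K := fun n => - f n.

Fact fps_addA : associative (@fps_add K : fps K -> fps K -> fps K).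
Proof. by move=> f g h; apply/funext => n; rewrite /fps_add addrA. Qed.

Fact fps_addC : commutative (@fps_add K : fps K -> fps K -> fps K).
Proof. by move=> f g; apply/funext => n; rewrite /fps_add addrC. Qed.

Fact fps_add0 : left_id (fps_const 0 : fps K) (@fps_add K).
Proof.
by move=> f; apply/funext => n; rewrite /fps_add /fps_const if_same add0r.
Qed.

Fact fps_addN : left_inverse (fps_const 0 : fps K) fps_opp (@fps_add K).
Proof.
by move=> f; apply/funext => n; rewrite /fps_add /fps_const if_same addNr.
Qed.

HB.instance Definition _ :=
  GRing.isZmodule.Build (fps K) fps_addA fps_addC fps_add0 fps_addN.

(** A coefficient of a product involves no coefficient of higher degree, so truncation is harmless
    and the product laws can be inherited from polynomials. *)
Lemma fps_mul_poly (f g : fps K) (n N : nat) : (n < N)%N ->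
  fps_mul f g n = (\poly_(i < N) f i * \poly_(i < N) g i)`_n.
Proof.
move=> lt_nN; rewrite coefM; apply: eq_bigr => i _; rewrite !coef_poly.
by rewrite !(leq_ltn_trans _ lt_nN) ?leq_subr // -ltnS.
Qed.

Fact fps_mulC : commutative (@fps_mul K : fps K -> fps K -> fps K).
Proof.
by move=> f g; apply/funext => n; rewrite !(fps_mul_poly _ _ (ltnSn n)) mulrC.
Qed.

Fact fps_mulA : associative (@fps_mul K : fps K -> fps K -> fps K).
Proof.
move=> f g h; apply/funext => n.
(* Both bracketings are compared with the degree [n] coefficient of one triple product of
   truncations. *)
transitivity (\poly_(i < n.+1) f i * (\poly_(i < n.+1) g i *
   \poly_(i < n.+1) h i))`_n.
  rewrite coefM; apply: eq_bigr => i _; rewrite coef_poly ltn_ord.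
  by rewrite -fps_mul_poly // ltnS leq_subr.
rewrite mulrA coefM; apply: eq_bigr => i _; rewrite coef_poly.
by rewrite -fps_mul_poly // !ltnS leq_subr.
Qed.

Fact fps_mul1 : left_id (fps_const 1 : fps K) (@fps_mul K).
Proof.
move=> f; apply/funext => n; rewrite /fps_mul big_ord_recl /= subn0 mul1r.
by rewrite big1 ?addr0 // => i _; rewrite mul0r.
Qed.

Fact fps_mulDl : left_distributive (@fps_mul K : fps K -> _) (@fps_add K).
Proof.
move=> f g h; apply/funext => n; rewrite /fps_add /fps_mul -big_split /=.
by apply: eq_bigr => i _; rewrite mulrDl.
Qed.

Fact fps_one_neq0 : (fps_const 1 : fps K) != fps_const 0.
Proof. by apply/eqP => /(congr1 (@^~ 0%N))/eqP; rewrite oner_eq0. Qed.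

HB.instance Definition _ := GRing.Zmodule_isComNzRing.Build (fps K)
  fps_mulA fps_mulC fps_mul1 fps_mulDl fps_one_neq0.

Lemma fps_expE (f : fps K) (r : nat) : fps_exp f r = f ^+ r :> fps K.
Proof. by elim: r => //= r IHr; rewrite exprS -IHr. Qed.

Lemma fps_coefD (f g : fps K) (n : nat) : (f + g) n = f n + g n.
Proof. by []. Qed.

Lemma fps_coefM (f g : fps K) (n : nat) :
  (f * g) n = \sum_(i < n.+1) f i * g (n - i)%N.
Proof. by []. Qed.

Lemma fps_coefN (f : fps K) (n : nat) : (- f) n = - f n.
Proof. by []. Qed.

Lemma fps_sumE (I : Type) (s : seq I) (P : pred I) (F : I -> fps K) (n : nat) :
  (\sum_(i <- s | P i) F i) n = \sum_(i <- s | P i) F i n.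
Proof.
elim/big_rec2: _ => [|i u f _ <-]; last by rewrite fps_coefD.
exact: (if_same (n == 0)%N).
Qed.

Lemma fps_signE (f : fps K) (l n : nat) :
  ((-1) ^+ l * f) n = (-1) ^+ l * f n.
Proof.
elim: l => [|l IHl]; first by rewrite !expr0 !mul1r.
by rewrite !exprS -!mulrA !mulN1r fps_coefN IHl.
Qed.

(** The substitution of [c * t] for [t], compatible with the ring operations. *)
Definition fps_scale (c : K) (f : fps K) : fps K := fun n => c ^+ n * f n.

Lemma fps_scaleM (c : K) (f g : fps K) :
  fps_scale c (f * g) = fps_scale c f * fps_scale c g.
Proof.
apply/funext => n; rewrite fps_coefM /fps_scale fps_coefM mulr_sumr.
by apply: eq_bigr => i _; rewrite mulrACA -exprD subnKC // -ltnS.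
Qed.

Lemma fps_scaleD (c : K) (f g : fps K) :
  fps_scale c (f + g) = fps_scale c f + fps_scale c g.
Proof. by apply/funext => n; rewrite /fps_scale !fps_coefD mulrDr. Qed.

Lemma fps_scale_const (c a : K) :
  fps_scale c (fps_const a) = fps_const a.
Proof.
by apply/funext => -[|n]; rewrite /fps_scale /fps_const /= ?mul1r ?mulr0.
Qed.

Lemma fps_scaleX (c : K) (f : fps K) (r : nat) :
  fps_scale c (f ^+ r) = fps_scale c f ^+ r.
Proof.
elim: r => [|r IHr]; first exact: fps_scale_const.
by rewrite !exprS fps_scaleM IHr.
Qed.

End FpsRing.

(** * Degenerate exponentials in characteristic zero *)

Section DegenerateExponential.
Variable K : fieldType.
Hypothesis char0 : [pchar K] =i pred0.

Let natr_neq0 (n : nat) : (0 < n)%N -> n%:R != 0 :> K.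
Proof. by move=> n_gt0; rewrite ((pcharf0P K).1 char0) -lt0n. Qed.

Let fact_neq0 (n : nat) : n`!%:R != 0 :> K.
Proof. exact/natr_neq0/fact_gt0. Qed.

(** Binomial convolution of exponential generating functions, from [n! = C(n, i) i! (n - i)!]. *)
Lemma egf_coefM (f g : fps K) (n : nat) :
  n`!%:R * (f * g) n =
  \sum_(i < n.+1) 'C(n, i)%:R * (i`!%:R * f i) * ((n - i)`!%:R * g (n - i)%N).
Proof.
rewrite fps_coefM mulr_sumr; apply: eq_bigr => i _.
have le_in : (i <= n)%N by rewrite -ltnS.
by rewrite -(bin_fact le_in) !natrM; ring.
Qed.

(** Coefficient form of the differential equation [(1 + lambda t) F' = x F]. *)
Lemma dexpS (lambda x : K) (n : nat) :
  n.+1%:R * dexp lambda x n.+1 = (x - n%:R * lambda) * dexp lambda x n.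
Proof.
rewrite /dexp /dfact big_ord_recr factS natrM /=.
by field; rewrite fact_neq0 nat1r natr_neq0.
Qed.

Lemma dexp0 (lambda : K) : dexp lambda 0 = 1 :> fps K.
Proof.
apply/funext => -[|n]; first by rewrite /dexp /dfact big_ord0 divr1.
by rewrite /dexp /dfact big_ord_recl /= mul0r subr0 !mul0r.
Qed.

(* The coefficients of (1 + lambda t)^(x / lambda) are determined by the
   recurrence dexpS, which the product also satisfies. *)
Lemma dexpD (lambda x y : K) :
  dexp lambda (x + y) = (dexp lambda x : fps K) * dexp lambda y.
Proof.
set u := dexp lambda x; set v := dexp lambda y.
apply/funext; elim=> [|n IHn].
  rewrite fps_coefM big_ord1.
  by rewrite /u /v /dexp /dfact !big_ord0 !divr1 mulr1.
apply: (mulfI (natr_neq0 (ltn0Sn n))).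
rewrite dexpS {}IHn !fps_coefM !mulr_sumr.
(* Leibniz rule: the factor [n + 1] is split as [i + (n + 1 - i)]. *)
transitivity (\sum_(i < n.+2) i%:R * u i * v (n.+1 - i)%N
  + \sum_(i < n.+2) u i * ((n.+1 - i)%:R * v (n.+1 - i)%N)); last first.
  rewrite -big_split; apply: eq_bigr => i _ /=.
  by rewrite natrB -1?ltnS //; ring.
(* The first sum loses its term [i = 0] and the second its term [i = n + 1]. Termwise, [(x - i
   lambda) + (y - (n - i) lambda) = x + y - n lambda]. *)
rewrite [X in _ = X + _]big_ord_recl /= !mul0r add0r.
rewrite [X in _ = _ + X]big_ord_recr /=.
rewrite subnn mul0r mulr0 addr0 -big_split; apply: eq_bigr => i _ /=.
rewrite /bump add1n subSS subSn -1?ltnS // !dexpS natrB -1?ltnS //.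
by rewrite -/u -/v; ring.
Qed.

Lemma dexpX (lambda x : K) (l : nat) :
  dexp lambda (x * l%:R) = (dexp lambda x : fps K) ^+ l.
Proof.
elim: l => [|l IHl]; first by rewrite mulr0 dexp0.
by rewrite -[l.+1]add1n natrD mulrDr mulr1 dexpD IHl exprS.
Qed.

(** Each of the [n] factors absorbs one [c]: [c (x - i lambda / c) = c x - i lambda]. *)
Lemma fps_scale_dexp (lambda c x : K) : c != 0 ->
  fps_scale c (dexp (lambda / c) x) = dexp lambda (c * x).
Proof.
move=> c0; apply/funext => n; rewrite /fps_scale /dexp mulrA; congr (_ / _).
rewrite -[X in c ^+ X]card_ord -prodr_const -big_split /=.
by apply: eq_bigr => i _; field.
Qed.

(** The inverse of [(1 + lambda t)^(c / lambda) + 1], in the form that arises when [fps_scale c] is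
    applied to [deuler_gf] with parameter [lambda / c]. *)
Definition dexp1_inv (lambda c : K) : fps K :=
  fps_scale c (fps_inv (fps_add (dexp (lambda / c) 1) (fps_const 1))).

Lemma dexp1_invP (lambda c : K) : c != 0 ->
  dexp1_inv lambda c * ((dexp lambda c : fps K) + 1) = 1.
Proof.
move=> c0; have -> : (dexp lambda c : fps K) + 1 =
    fps_scale c (fps_add (dexp (lambda / c) 1) (fps_const 1)).
  by rewrite fps_scaleD fps_scale_const fps_scale_dexp // mulr1.
rewrite -fps_scaleM -[1 in RHS](fps_scale_const c); congr fps_scale.
apply/funext; apply: fps_mulVf.
(* The constant term is 2, nonzero in characteristic zero. *)
rewrite /fps_add /dexp /dfact big_ord0 divr1 /fps_const eqxx -mulr2n.
exact: natr_neq0.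
Qed.

Lemma fps_scale_deuler_gf (lambda c x : K) (r : nat) : c != 0 ->
  fps_scale c (deuler_gf r x (lambda / c)) =
  ((fps_const 2 : fps K) * dexp1_inv lambda c) ^+ r * dexp lambda (c * x).
Proof.
move=> c0; rewrite /deuler_gf fps_expE fps_scaleM fps_scaleX fps_scaleM.
by rewrite fps_scale_const fps_scale_dexp.
Qed.

(** * Alternating sums and the symmetric generating function *)

Definition alt_dexp_sum (lambda b : K) (a : nat) : fps K :=
  \sum_(l < a) (-1) ^+ l * (dexp lambda b : fps K) ^+ l.

Lemma alt_dexp_sumE (lambda b : K) (a : nat) : b != 0 -> odd a ->
  alt_dexp_sum lambda b a =
  ((dexp lambda (b * a%:R) : fps K) + 1) * dexp1_inv lambda b.
Proof.
move=> b0 odd_a; set E : fps K := dexp lambda b.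
have geo : alt_dexp_sum lambda b a * (E + 1) = E ^+ a + 1.
  (* Geometric sum of ratio [- E]; for odd [a], [(- E)^a - 1 = - (E^a + 1)]. *)
  have := subrX1 (- E) a; rewrite exprNn -signr_odd odd_a expr1 mulN1r.
  under eq_bigr => i _ do rewrite exprNn.
  rewrite -/(alt_dexp_sum _ _ _) => geo.
  by rewrite -[RHS]opprK opprD geo -opprD mulNr opprK mulrC.
by rewrite dexpX -geo -mulrA [X in _ * X]mulrC dexp1_invP ?mulr1.
Qed.

(** Since [E^l] is the exponential at [b l], rescaling by [b] gives it the degree [k] coefficient
    [b^k (l | lambda / b)_k / k!]. *)
Lemma alt_dexp_sum_coef (lambda : K) (a b k : nat) : (0 < a)%N -> (0 < b)%N ->
  b%:R ^+ k * dSsum k (a - 1) (lambda / b%:R) =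
  k`!%:R * alt_dexp_sum lambda b%:R a k.
Proof.
move=> a_gt0 b_gt0; rewrite /dSsum subn1 prednK //.
rewrite /alt_dexp_sum fps_sumE !mulr_sumr.
apply: eq_bigr => l _; rewrite -dexpX fps_signE.
rewrite -fps_scale_dexp ?natr_neq0 // /fps_scale /dexp.
by field; rewrite fact_neq0.
Qed.

(** Two nested binomial convolutions; the powers of [a] and [b] are absorbed by the substitutions,
    [b^j] being shared as [b^k b^(j - k)] in the inner one. *)
Lemma deuler_symmetry_sumE (lambda x y : K) (a b n m : nat) :
  (0 < a)%N -> (0 < b)%N ->
  \sum_(j < n.+1)
     'C(n, j)%:R * b%:R ^+ j * a%:R ^+ (n - j)
     * deuler m.+1 (n - j) (b%:R * x) (lambda / a%:R)
     * \sum_(k < j.+1)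
          dSsum k (a - 1) (lambda / b%:R) * 'C(j, k)%:R
          * deuler m (j - k) (a%:R * y) (lambda / b%:R)
  = n`!%:R * (alt_dexp_sum lambda b%:R a
      * fps_scale b%:R (deuler_gf m (a%:R * y) (lambda / b%:R))
      * fps_scale a%:R (deuler_gf m.+1 (b%:R * x) (lambda / a%:R))) n.
Proof.
move=> a_gt0 b_gt0; rewrite egf_coefM; apply: eq_bigr => j _.
rewrite egf_coefM [X in _ = _ * X * _](_ : _ = b%:R ^+ j * \sum_(k < j.+1)
          dSsum k (a - 1) (lambda / b%:R) * 'C(j, k)%:R
          * deuler m (j - k) (a%:R * y) (lambda / b%:R)).
  by rewrite /fps_scale /deuler; ring.
rewrite mulr_sumr; apply: eq_bigr => k _.
have le_kj : (k <= j)%N by rewrite -ltnS.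
have -> : b%:R ^+ j = b%:R ^+ k * b%:R ^+ (j - k) :> K.
  by rewrite -exprD subnKC.
by rewrite -alt_dexp_sum_coef // /fps_scale /deuler; ring.
Qed.

Lemma deuler_symmetry (lambda x y : K) (a b n m : nat) :
  odd a -> odd b -> (0 < a)%N -> (0 < b)%N ->
  \sum_(j < n.+1)
     'C(n, j)%:R * b%:R ^+ j * a%:R ^+ (n - j)
     * deuler m.+1 (n - j) (b%:R * x) (lambda / a%:R)
     * \sum_(k < j.+1)
          dSsum k (a - 1) (lambda / b%:R) * 'C(j, k)%:R
          * deuler m (j - k) (a%:R * y) (lambda / b%:R)
  =
  \sum_(j < n.+1)
     'C(n, j)%:R * a%:R ^+ j * b%:R ^+ (n - j)
     * deuler m.+1 (n - j) (a%:R * x) (lambda / b%:R)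
     * \sum_(k < j.+1)
          dSsum k (b - 1) (lambda / a%:R) * 'C(j, k)%:R
          * deuler m (j - k) (b%:R * y) (lambda / a%:R).
Proof.
move=> odd_a odd_b a_gt0 b_gt0; rewrite !deuler_symmetry_sumE //.
congr (_ * _); apply: (congr1 (fun f : fps K => f n)).
have [a0 b0] := (natr_neq0 a_gt0, natr_neq0 b_gt0).
rewrite !fps_scale_deuler_gf // !alt_dexp_sumE // !mulrA.
(* With [e(z)] for [dexp lambda z], both sides are [2^(2m+1) (e(ab) + 1) e(abx) e(aby) / ((e(a) + 1)
   (e(b) + 1))^(m+1)]. The arguments of [dexp] are opaque to [ring], so [a b] and [b a] are
   identified first. *)
by rewrite (mulrC a%:R b%:R) !exprS; ring.
Qed.

End DegenerateExponential.

(** The tower embeds the rationals in [C], and morphisms of fields are injective. *)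
Lemma pchar_Cp (R : realType) (p : nat) (C : padicComplex R p) :
  [pchar C] =i pred0.
Proof.
apply/pcharf0P => n.
pose f : {rmorphism rat -> C} :=
  @Qpbar_Cp R p C \o @Qp_Qpbar R p C \o @rat_Qp R p C.
by rewrite -(rmorph_nat f) fmorph_eq0 pnatr_eq0.
Qed.

Unset Implicit Arguments.

Theorem theorem1 (R : realType) (p : nat) (C : padicComplex R p)
    (lambda x y : C) (w1 w2 n m : nat)
    (p_prime : prime p) (p_odd : odd p)
    (lambda_neq0 : lambda != 0)
    (w1_gt0 : (0 < w1)%N) (w2_gt0 : (0 < w2)%N)
    (w1_odd : w1 = 1 %[mod 2]) (w2_odd : w2 = 1 %[mod 2])
    (m_gt0 : (0 < m)%N) :
  \sum_(j < n.+1)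
     'C(n, j)%:R * w2%:R ^+ j * w1%:R ^+ (n - j)
     * deuler m (n - j) (w2%:R * x) (lambda / w1%:R)
     * \sum_(k < j.+1)
          dSsum k (w1 - 1) (lambda / w2%:R) * 'C(j, k)%:R
          * deuler (m - 1) (j - k) (w1%:R * y) (lambda / w2%:R)
  =
  \sum_(j < n.+1)
     'C(n, j)%:R * w1%:R ^+ j * w2%:R ^+ (n - j)
     * deuler m (n - j) (w1%:R * x) (lambda / w2%:R)
     * \sum_(k < j.+1)
          dSsum k (w2 - 1) (lambda / w1%:R) * 'C(j, k)%:R
          * deuler (m - 1) (j - k) (w2%:R * y) (lambda / w1%:R).
Proof.
(* Writing [m] as a successor removes the truncated subtraction [m - 1]. *)
case: m m_gt0 => // m _; rewrite [(m.+1 - 1)%N]subn1 /=.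
have odd_mod w : w = 1 %[mod 2] -> odd w by rewrite !modn2; case: odd.
by apply: (deuler_symmetry (@pchar_Cp R p C)) => //; exact: odd_mod.
Qed.
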